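(* (Invariance principle.) Let $F$ be a field, let $\mathcal{V}$ and $\mathcal{W}$ be vector spaces over $F$ of finite dimensions $n$ and $m$, let $G$ be a subgroup of $GL_n(F)$, and let $A:G\to GL_m(F)$ be a group homomorphism. Consider a geometrical object of type $A$ defined in $\mathcal{V}$, that is, an orbit of the form $$\{(wA(a)^{-1},\,L(a)\overline{\overline{e}}_{\mathcal{W}},\,L(a)\overline{\overline{e}}_{\mathcal{V}}):a\in G\},$$ where $\overline{\overline{e}}_{\mathcal{V}}=\langle e_i\rangle$ is a basis of $\mathcal{V}$, $\overline{\overline{e}}_{\mathcal{W}}=\langle E_\alpha\rangle$ is a basis of $\mathcal{W}$, and $w=(w^\alpha)\in F^m$. Then the representative of the geometrical object does not depend on the selection of the basis $\overline{\overline{e}}'_{\mathcal{V}}=L(a)\overline{\overline{e}}_{\mathcal{V}}$: for every $a\in G$, if $E'_\alpha=\sum_\beta A(a)^\beta_\alpha E_\beta$ and $w'^\alpha=\sum_\beta w^\beta (A(a)^{-1})^\alpha_\beta$, then $$\sum_\alpha w'^\alpha E'_\alpha=\sum_\alpha w^\alpha E_\alpha .$$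
   Context: Matrix convention: in $x^i_j$ the lower index $j$ enumerates rows and the upper index $i$ enumerates columns, so $(xy)^k_j=\sum_i x^i_j y^k_i$. For a row $w\in F^m$ and a matrix $x\in GL_m(F)$, $(wx)^\alpha=\sum_\beta w^\beta x^\alpha_\beta$. Passive transformations of bases: for $a\in G$, $L(a)\langle e_i\rangle=\langle e'_j\rangle$ with $e'_j=\sum_i a^i_j e_i$ for a basis of $\mathcal{V}$, and $L(a)\langle E_\alpha\rangle=\langle E'_\alpha\rangle$ with $E'_\alpha=\sum_\beta A(a)^\beta_\alpha E_\beta$ for a basis of $\mathcal{W}$. For the basis $\overline{\overline{e}}'_{\mathcal{V}}=L(a)\overline{\overline{e}}_{\mathcal{V}}$, the corresponding point of the orbit gives the coordinates $(w'^\alpha)=wA(a)^{-1}$ of the geometrical object relative to $\overline{\overline{e}}'_{\mathcal{V}}$, and the vector $\sum_\alpha w'^\alpha E'_\alpha\in\mathcal{W}$ is called the representative of the geometrical object in the basis $\overline{\overline{e}}'_{\mathcal{V}}$. *)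

(* Defs.v *)
From HB Require Import structures.
From mathcomp Require Import all_boot all_order all_algebra.

Set Implicit Arguments.
Unset Strict Implicit.
Unset Printing Implicit Defensive.

Import GRing.Theory.
Local Open Scope ring_scope.

(* The entry written x^i_j in index notation (lower index = row) is [x j i];
   with this reading the product is the usual [*m] and a coordinate row is
   multiplied by a matrix on the right. *)

(* {'GL_n[F]} is only available over finite fields and for n > 0, hence
   subgroups of GL_n(F) are closed families of invertible matrices. *)
Record subgroup_GL (F : fieldType) (n : nat) (G : 'M[F]_n -> Prop) : Prop := {
  subGL_unit : forall a, G a -> a \in unitmx;
  subGL_1 : G 1%:M;
  subGL_M : forall a b, G a -> G b -> G (a *m b);
  subGL_V : forall a, G a -> G (invmx a) }.

(* Only the values of A on G are meaningful. *)
Record hom_GL (F : fieldType) (n m : nat) (G : 'M[F]_n -> Prop)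
    (A : 'M[F]_n -> 'M[F]_m) : Prop := {
  homGL_unit : forall a, G a -> A a \in unitmx;
  homGL_M : forall a b, G a -> G b -> A (a *m b) = A a *m A b }.

(* e'_j = sum_i x^i_j e_i.  L(a) is [passive a] on bases of V and
   [passive (A a)] on bases of W. *)
Definition passive (F : fieldType) (U : vectType F) (k : nat) (x : 'M[F]_k)
    (e : k.-tuple U) : k.-tuple U :=
  [tuple \sum_i x j i *: tnth e i | j < k].

Definition vec_of_coord (F : fieldType) (U : vectType F) (k : nat)
    (w : 'rV[F]_k) (e : k.-tuple U) : U :=
  \sum_i w 0 i *: tnth e i.

Definition geometrical_object (F : fieldType) (V W : vectType F) (n m : nat)
    (G : 'M[F]_n -> Prop) (A : 'M[F]_n -> 'M[F]_m)
    (w : 'rV[F]_m) (eW : m.-tuple W) (eV : n.-tuple V) :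
    'rV[F]_m * m.-tuple W * n.-tuple V -> Prop :=
  fun p => exists2 a, G a &
    p = (w *m invmx (A a), passive (A a) eW, passive a eV).

(* A relation, since it is only determined through a point of the orbit
   lying over the basis e'; that v exists and is unique is not built in. *)
Definition is_representative (F : fieldType) (V W : vectType F) (n m : nat)
    (Omega : 'rV[F]_m * m.-tuple W * n.-tuple V -> Prop)
    (e' : n.-tuple V) (v : W) : Prop :=
  exists (w' : 'rV[F]_m) (E' : m.-tuple W),
    Omega (w', E', e') /\ v = vec_of_coord w' E'.

(* Main.v *)
(* Passing to the basis x e multiplies the row of coordinates by x on the right,
   so w A(a)^-1 taken in the basis A(a) e_W has coordinates w A(a)^-1 A(a) = w in
   e_W. This holds at every point of the orbit, so any two points lying over the
   same basis of V give the same representative. *)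

Require Import Defs.
From HB Require Import structures.
From mathcomp Require Import all_boot all_order all_algebra.

Set Implicit Arguments.
Unset Strict Implicit.
Unset Printing Implicit Defensive.

Import GRing.Theory.
Local Open Scope ring_scope.

(** Both sides are the double sum of [(w 0 j * x j i) *: tnth e i], taken in the two orders of
    summation. *)
Lemma vec_of_coord_passive (F : fieldType) (U : vectType F) (k : nat)
    (x : 'M[F]_k) (w : 'rV[F]_k) (e : k.-tuple U) :
  vec_of_coord w (passive x e) = vec_of_coord (w *m x) e.
Proof.
rewrite /vec_of_coord; under eq_bigr do rewrite tnth_mktuple scaler_sumr.
rewrite exchange_big; apply: eq_bigr => i _.
by rewrite mxE scaler_suml; apply: eq_bigr => j _; rewrite scalerA.
Qed.

Lemma vec_of_coord_passiveVK (F : fieldType) (U : vectType F) (k : nat)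
    (x : 'M[F]_k) (w : 'rV[F]_k) (e : k.-tuple U) :
  x \in unitmx -> vec_of_coord (w *m invmx x) (passive x e) = vec_of_coord w e.
Proof. by move=> ux; rewrite vec_of_coord_passive mulmxKV. Qed.

Theorem theorem6p4 (F : fieldType) (V W : vectType F) (n m : nat)
    (dimV : \dim {:V} = n) (dimW : \dim {:W} = m)
    (G : 'M[F]_n -> Prop) (hG : subgroup_GL G)
    (A : 'M[F]_n -> 'M[F]_m) (hA : hom_GL G A)
    (eV : n.-tuple V) (heV : basis_of {:V} eV)
    (eW : m.-tuple W) (heW : basis_of {:W} eW)
    (w : 'rV[F]_m) :
  forall a : 'M[F]_n, G a ->
    (forall v : W,
       is_representative (geometrical_object G A w eW eV) (passive a eV) v <->
       v = \sum_alpha w 0 alpha *: tnth eW alpha) /\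
    (forall (E' : m.-tuple W) (w' : 'rV[F]_m),
       (forall alpha, tnth E' alpha =
          \sum_beta A a alpha beta *: tnth eW beta) ->
       (forall alpha, w' 0 alpha =
          \sum_beta w 0 beta * invmx (A a) beta alpha) ->
       \sum_alpha w' 0 alpha *: tnth E' alpha =
       \sum_alpha w 0 alpha *: tnth eW alpha).
Proof.
move=> a Ga; split=> [v|E' w' hE' hw'].
  (* The orbit point over [passive a eV] comes with its own [b] in [G], which is not identified with
     [a]: cancelling [A b] already yields the vector of [w] in [eW]. *)
  split=> [[w' [E' [[b Gb [-> -> _]] ->]]]|->].
    by rewrite vec_of_coord_passiveVK // (homGL_unit hA).
  (* Existence: the orbit point given by [a] itself lies over [passive a eV]. *)
  exists (w *m invmx (A a)), (passive (A a) eW); split; first by exists a.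
  by rewrite vec_of_coord_passiveVK // (homGL_unit hA).
(* The entrywise formulas make [E'] and [w'] the components of the orbit point at [a], so the same
   cancellation applies. *)
have -> : E' = passive (A a) eW.
  by apply: eq_from_tnth => i; rewrite hE' tnth_mktuple.
have -> : w' = w *m invmx (A a) by apply/rowP => i; rewrite hw' mxE.
exact/vec_of_coord_passiveVK/(homGL_unit hA).
Qed.
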